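(* There is an extensional ESO sentence $\Gamma$ such that the problem described by $\Gamma$ is polynomial-time equivalent to the complement of the Monotone Dual problem. (Equivalently, deciding $\lnot\Gamma$ is polynomial-time equivalent to Monotone Dual.)
   Context: All signatures are finite and relational, and all structures have non-empty domains. An ESO $\tau$-sentence has the form $\exists R_1,\dots,R_k.\,\phi$, where $R_1,\dots,R_k\notin\tau$ and $\phi$ is a first-order $(\tau\cup\{R_1,\dots,R_k\})$-sentence. The problem it describes is the class of finite $\tau$-structures satisfying it. It is extensional if for every existentially quantified predicate $R$ there is a distinct symbol $R'\in\tau$ of the same arity such that the sentence contains a conjunct $\forall\bar x\,(R'(\bar x)\Rightarrow R(\bar x))$, and $R'$ does not appear anywhere else in the sentence. Two problems are polynomial-time equivalent if there are polynomial-time many-one reductions in both directions. The dual of a Boolean function $f\colon\{0,1\}^n\to\{0,1\}$ is the function $f^d(x_1,\dots,x_n):=1-f(1-x_1,\dots,1-x_n)$. The Monotone Dual problem is: given Boolean functions $f$ and $g$ represented by propositional formulas $\phi$ and $\psi$ in conjunctive normal form without negative literals, decide whether $g$ is the dual of $f$. (The constant $0$ is represented by an empty clause and the constant $1$ by an empty set of clauses.) *)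

(* Defs.v *)
From HB Require Import structures.
From mathcomp Require Import all_boot.

Set Implicit Arguments.
Unset Strict Implicit.
Unset Printing Implicit Defensive.

(** * First-order logic over finite relational signatures *)

Record signature := Signature { symbol : finType; arity : symbol -> nat }.

Definition sig_sum (tau rho : signature) : signature :=
  @Signature (symbol tau + symbol rho)%type
    (fun S => match S with inl R => arity R | inr R => arity R end).

(** First-order formulas with equality; variables are named by natural
    numbers. *)
Inductive formula (tau : signature) : Type :=
| FAtom (R : symbol tau) of (arity R).-tuple nat
| FEq of nat & nat
| FNot of formula tau
| FAnd of formula tau & formula tau
| FOr of formula tau & formula tau
| FImp of formula tau & formula tau
| FForall of nat & formula tau
| FExists of nat & formula tau.

Fixpoint free_vars tau (phi : formula tau) : seq nat :=
  match phi with
  | FAtom R xs => xs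
  | FEq x y => [:: x; y]
  | FNot a => free_vars a
  | FAnd a b | FOr a b | FImp a b => free_vars a ++ free_vars b
  | FForall x a | FExists x a => [seq y <- free_vars a | y != x]
  end.

Definition is_sentence tau (phi : formula tau) : bool := free_vars phi == [::].

Definition interpretation (tau : signature) (D : finType) : Type :=
  forall R : symbol tau, {set (arity R).-tuple D}.

Definition update (D : Type) (v : nat -> D) (x : nat) (d : D) : nat -> D :=
  fun y => if y == x then d else v y.

Fixpoint holds tau (D : finType) (A : interpretation tau D) (v : nat -> D)
    (phi : formula tau) : bool :=
  match phi with
  | FAtom R xs => map_tuple v xs \in A R
  | FEq x y => v x == v y
  | FNot a => ~~ holds A v a
  | FAnd a b => holds A v a && holds A v b
  | FOr a b => holds A v a || holds A v b
  | FImp a b => holds A v a ==> holds A v b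
  | FForall x a => [forall d : D, holds A (update v x d) a]
  | FExists x a => [exists d : D, holds A (update v x d) a]
  end.

Fixpoint occurrences tau (S : symbol tau) (phi : formula tau) : nat :=
  match phi with
  | FAtom R _ => R == S
  | FEq _ _ => 0
  | FNot a => occurrences S a
  | FAnd a b | FOr a b | FImp a b => occurrences S a + occurrences S b
  | FForall _ a | FExists _ a => occurrences S a
  end.

Fixpoint has_conjunct tau (chi phi : formula tau) : Prop :=
  phi = chi \/
  match phi with
  | FAnd a b => has_conjunct chi a \/ has_conjunct chi b
  | _ => False
  end.

(** * Existential second-order sentences *)

(** The symbols of [eso_new] are the existentially quantified predicates; they
    are kept apart from those of [tau] by the disjoint union. *)
Record eso (tau : signature) := Eso {
  eso_new : signature;
  eso_matrix : formula (sig_sum tau eso_new);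
  eso_closed : is_sentence eso_matrix
}.

Definition expand tau rho (D : finType) (A : interpretation tau D)
    (B : interpretation rho D) : interpretation (sig_sum tau rho) D :=
  fun S => match S return {set (@arity (sig_sum tau rho) S).-tuple D} with
           | inl R => A R
           | inr R => B R
           end.

(** The matrix has no free variables, so its value does not depend on the assignment. *)
Definition eso_holds tau (D : finType) (A : interpretation tau D)
    (Gamma : eso tau) : Prop :=
  exists B : interpretation (eso_new Gamma) D,
    forall v : nat -> D, holds (expand A B) v (eso_matrix Gamma).

(** The formula [forall xs, R'(xs) => R(xs)]. *)
Definition extension_clause tau rho (R' : symbol tau) (R : symbol rho)
    (e : arity R' = arity R) (xs : (arity R').-tuple nat) :
    formula (sig_sum tau rho) :=
  foldr (@FForall _)
    (FImp (@FAtom (sig_sum tau rho) (inl R') xs)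
          (@FAtom (sig_sum tau rho) (inr R) (tcast e xs)))
    xs.

(** The extension clause contains [R'] once, so a total count of one says that
    [R'] occurs nowhere else. *)
Definition extensional tau (Gamma : eso tau) : Prop :=
  exists prime : symbol (eso_new Gamma) -> symbol tau,
    injective prime /\
    forall R : symbol (eso_new Gamma),
      (exists (e : arity (prime R) = arity R)
              (xs : (arity (prime R)).-tuple nat),
          uniq xs /\ has_conjunct (extension_clause e xs) (eso_matrix Gamma)) /\
      @occurrences (sig_sum tau (eso_new Gamma)) (inl (prime R))
        (eso_matrix Gamma) = 1.

(** * Multi-tape Turing machines *)

(** Tape cells hold a bit or the blank [None]. *)
Notation cell := (option bool).

(** [tape_left] lists the cells to the left of the head, nearest first;
    [tape_right] starts with the scanned cell.  All cells beyond the two lists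
    are blank, so the tape is infinite in both directions. *)
Record tape := Tape { tape_left : seq cell; tape_right : seq cell }.

Definition blank_tape : tape := Tape [::] [::].

Definition scanned (t : tape) : cell := head None (tape_right t).

Inductive direction := MoveLeft | Stay | MoveRight.

Definition write_move (t : tape) (a : cell * direction) : tape :=
  let: Tape l r := t in
  let: (c, d) := a in
  match d with
  | MoveLeft => Tape (behead l) (head None l :: c :: behead r)
  | Stay => Tape l (c :: behead r)
  | MoveRight => Tape (c :: l) (behead r)
  end.

(** Deterministic machines; [None] as value of the transition function means
    that the machine halts. *)
Record machine := Machine {
  ntapes : nat;
  state : finType;
  start : state;
  delta : state -> (ntapes.+1).-tuple cell ->
          option (state * (ntapes.+1).-tuple (cell * direction))
}.

Record config (M : machine) := Config {
  cfg_state : state M;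
  cfg_tapes : 'I_(ntapes M).+1 -> tape
}.

Definition transition (M : machine) (c : config M) :=
  delta (cfg_state c) [tuple scanned (cfg_tapes c i) | i < (ntapes M).+1].

Definition halted (M : machine) (c : config M) : bool := ~~ isSome (transition c).

Definition step (M : machine) (c : config M) : config M :=
  if transition c is Some (q, acts)
  then Config q (fun i => write_move (cfg_tapes c i) (tnth acts i))
  else c.

(** The input is written on the first tape, with the head on its first bit. *)
Definition initial (M : machine) (w : seq bool) : config M :=
  Config (start M)
    (fun i => if i == ord0 then Tape [::] (map Some w) else blank_tape).

Fixpoint blank_free_prefix (s : seq cell) : seq bool :=
  if s is Some b :: s' then b :: blank_free_prefix s' else [::].

(** The output is the word on the last tape that starts at the head and extends
    to the first blank. *)
Definition output (M : machine) (c : config M) : seq bool :=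
  blank_free_prefix (tape_right (cfg_tapes c ord_max)).

Definition computes_within (M : machine) (t : nat) (w w' : seq bool) : Prop :=
  let c := iter t (@step M) (initial M w) in halted c /\ output c = w'.

(** * Decision problems and polynomial-time reductions *)

Record problem := Problem {
  instance : Type;
  encode : instance -> seq bool;
  yes : instance -> Prop
}.

Definition complement (P : problem) : problem :=
  Problem (@encode P) (fun x => ~ yes x).

Definition polytime (P Q : problem) (f : instance P -> instance Q) : Prop :=
  exists (M : machine) (c d : nat), forall x : instance P,
    computes_within M (c * size (encode x) ^ d + c) (encode x) (encode (f x)).

Definition reduces (P Q : problem) : Prop :=
  exists f : instance P -> instance Q,
    polytime f /\ forall x, yes x <-> yes (f x).

Definition polytime_equivalent (P Q : problem) : Prop :=
  reduces P Q /\ reduces Q P.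

(** Self-delimiting binary codes. *)
Definition encode_nat (n : nat) : seq bool := rcons (nseq n true) false.

Definition encode_seq (T : Type) (enc : T -> seq bool) (s : seq T) : seq bool :=
  rcons (flatten [seq true :: enc x | x <- s]) false.

(** * The problem described by an ESO sentence *)

(** Up to isomorphism, a finite structure with non-empty domain has domain
    {0, ..., n}. *)
Record fin_structure (tau : signature) := FinStructure {
  last_element : nat;
  relation : interpretation tau 'I_last_element.+1
}.

(** All [k]-tuples over [s], in lexicographic order. *)
Fixpoint tuples_over (T : Type) (s : seq T) (k : nat) : seq (k.-tuple T) :=
  if k is k'.+1 then [seq cons_tuple x t | x <- s, t <- tuples_over s k']
  else [:: [tuple]].

(** The size of the domain in unary, followed by the characteristic bit strings
    of the relations. *)
Definition encode_structure tau (A : fin_structure tau) : seq bool :=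
  encode_nat (last_element A).+1 ++
  flatten [seq [seq t \in relation A R
                 | t <- tuples_over (enum 'I_(last_element A).+1) (arity R)]
            | R <- enum (symbol tau)].

Definition eso_problem tau (Gamma : eso tau) : problem :=
  Problem (@encode_structure tau) (fun A => eso_holds (relation A) Gamma).

(** * Monotone Dual *)

Definition boolean_function (n : nat) : Type := {ffun 'I_n -> bool} -> bool.

Definition dual n (f : boolean_function n) : boolean_function n :=
  fun x => ~~ f [ffun i => ~~ x i].

(** A CNF without negative literals: the list of its clauses, each clause being
    the list of its variables. *)
Definition monotone_cnf (n : nat) : Type := seq (seq 'I_n).

Definition cnf_function n (phi : monotone_cnf n) : boolean_function n :=
  fun x => all (fun clause => has (fun i => x i) clause) phi.

Record cnf_pair := CnfPair {
  nvars : nat;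
  cnf_f : monotone_cnf nvars;
  cnf_g : monotone_cnf nvars
}.

Definition encode_cnf n (phi : monotone_cnf n) : seq bool :=
  encode_seq (encode_seq (fun i : 'I_n => encode_nat i)) phi.

Definition encode_cnf_pair (I : cnf_pair) : seq bool :=
  encode_nat (nvars I) ++ encode_cnf (cnf_f I) ++ encode_cnf (cnf_g I).

Definition monotone_dual : problem :=
  Problem encode_cnf_pair
    (fun I => cnf_function (cnf_g I) =1 dual (cnf_function (cnf_f I))).

(* Main.v *)
From HB Require Import structures.
From mathcomp Require Import all_boot.
From mathcomp Require Import zify.
Require Import Defs.

Set Implicit Arguments.
Unset Strict Implicit.
Unset Printing Implicit Defensive.

(** A structure with a binary relation E is read as the monotone CNF h whose
    clauses are the rows of E. The sentence [balanced_sentence] asks for a set X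
    that contains a given set Y of forced elements and satisfies
    h(X) = h(not X), where [not X] is the complement; for empty Y it says that
    h is not self-dual.

    Forced elements can be expressed by the clauses of a pair. Let f have the
    rows of E, each enlarged by Y, and let g have the rows of E and a unit clause
    for each element of Y. If X does not contain Y then g(X) = 0 and
    f(not X) = 1, as duality requires; if it does, then g(X) = h(X) and
    f(not X) = h(not X). So f and g fail to be dual iff the sentence holds
    ([cnf_of_structure_correct]).

    Conversely, f and g are dual iff
    h = (y or z) and (y or f) and (z or g) is self-dual, where y and z are fresh
    variables ([structure_of_cnf_correct]). The matrix of h has to be square. As
    a domain size the length of the input word is taken, and the clause (y or z)
    is repeated to fill the matrix; as this clause is always present, neither
    empty CNFs nor empty clauses need special treatment.

    Both reductions are computed by explicit machines. These are written as
    structured programs with a sequence, a conditional and a loop, each with a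
    rule that bounds the running time ([runs_seq], [runs_if_true],
    [runs_while_true]), and are compiled to multi-tape machines by
    [polytime_of_runs]. The program [cnf_to_structure] emits one row of the
    matrix for each input bit, and [structure_to_cnf] reads the matrix once for
    each of the two CNFs.

    The same two maps reduce between the complements, because duality is a
    decidable property. *)

(** * Programs on four tapes *)

Inductive four (T : Type) := Four of T & T & T & T.

Definition get4 T (j : nat) (v : four T) : T :=
  let: Four a b c d := v in
  match j with 0 => a | 1 => b | 2 => c | _ => d end.

Definition set4 T (j : nat) (v : four T) (x : T) : four T :=
  let: Four a b c d := v in
  match j with
  | 0 => Four x b c d | 1 => Four a x c d
  | 2 => Four a b x d | _ => Four a b c x
  end.

Lemma get_set4 T j (v : four T) x : get4 j (set4 j v x) = x.
Proof. by case: v => a b c d; case: j => [|[|[|j]]]. Qed.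

Lemma set4_set4 T j (v : four T) x y : set4 j (set4 j v x) y = set4 j v y.
Proof. by case: v => a b c d; case: j => [|[|[|j]]]. Qed.

Lemma set4_get T j (v : four T) : set4 j v (get4 j v) = v.
Proof. by case: v => a b c d; case: j => [|[|[|j]]]. Qed.

(** A separate constructor for leaving a tape alone makes idle tapes compute: on
    real machines the scanned symbol has to be rewritten, which changes the
    representation of a tape whose right part is the empty list. *)
Inductive action := Keep | Put of cell & direction.

(** A blank is never stored at the far end of a tape, so that a tape erased to
    its end is literally equal to the empty one and programs can be specified
    by equations between tapes. *)
Definition push (c : cell) (s : seq cell) : seq cell :=
  if c is None then if s is [::] then [::] else c :: s else c :: s.

Definition act (t : tape) (a : action) : tape :=
  if a is Put c d then
    let: Tape l r := t in
    match d with
    | MoveLeft => Tape (behead l) (push (head None l) (push c (behead r)))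
    | Stay => Tape l (push c (behead r))
    | MoveRight => Tape (push c l) (behead r)
    end
  else t.

Definition act4 (T : four tape) (a : four action) : four tape :=
  let: Four t0 t1 t2 t3 := T in
  let: Four a0 a1 a2 a3 := a in
  Four (act t0 a0) (act t1 a1) (act t2 a2) (act t3 a3).

Definition scan (T : four tape) : four cell :=
  let: Four t0 t1 t2 t3 := T in
  Four (scanned t0) (scanned t1) (scanned t2) (scanned t3).

Definition idle : four action := Four Keep Keep Keep Keep.

Lemma act4_idle T : act4 T idle = T.
Proof. by case: T. Qed.

Lemma get_scan j T : get4 j (scan T) = scanned (get4 j T).
Proof. by case: T => a b c d; case: j => [|[|[|j]]]. Qed.

Lemma act4_set4 j T a : act4 T (set4 j idle a) = set4 j T (act (get4 j T) a).
Proof. by case: T => t0 t1 t2 t3; case: j => [|[|[|j]]]. Qed.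

(** Programs are machines with four tapes; they halt by having no next step,
    which lets them be composed by redirecting the halting states. *)
Record prog := Prog {
  pstate : finType;
  pstart : pstate;
  pdelta : pstate -> four cell -> option (pstate * four action)
}.

Inductive halts (p : prog) : pstate p -> four tape -> nat -> four tape -> Prop :=
| HaltsNow s T : pdelta s (scan T) = None -> halts s T 0 T
| HaltsLater s T s1 a n T' :
    pdelta s (scan T) = Some (s1, a) -> halts s1 (act4 T a) n T' ->
    halts s T n.+1 T'.

(** The number of steps is an upper bound, so that bounds can be rounded up. *)
Definition runs (p : prog) (T T' : four tape) (n : nat) : Prop :=
  exists2 m, m <= n & halts (pstart p) T m T'.

Definition do_prog (f : four cell -> four action) : prog :=
  @Prog bool false (fun s v => if s then None else Some (true, f v)).

Definition seq_prog (p q : prog) : prog :=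
  @Prog (pstate p + pstate q)%type (inl (pstart p)) (fun s v =>
    match s with
    | inl s => if pdelta s v is Some x then Some (inl x.1, x.2)
               else Some (inr (pstart q), idle)
    | inr s => omap (fun x => (inr x.1, x.2)) (pdelta s v)
    end).

Definition if_prog (b : four cell -> bool) (p : prog) : prog :=
  @Prog (option (pstate p)) None (fun s v =>
    match s with
    | None => if b v then Some (Some (pstart p), idle) else None
    | Some s => omap (fun x => (Some x.1, x.2)) (pdelta s v)
    end).

Definition while_prog (b : four cell -> bool) (p : prog) : prog :=
  @Prog (option (pstate p)) None (fun s v =>
    match s with
    | None => if b v then Some (Some (pstart p), idle) else None
    | Some s => if pdelta s v is Some x then Some (Some x.1, x.2)
                else Some (None, idle)
    end).

Notation "p ;; q" := (seq_prog p q) (at level 61, right associativity).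

Lemma runs_le p T T' n m : n <= m -> runs p T T' n -> runs p T T' m.
Proof. by move=> le_nm [k le_kn h]; exists k => //; apply: leq_trans le_nm. Qed.

Lemma runs_do f T T' : T' = act4 T (f (scan T)) -> runs (do_prog f) T T' 1.
Proof. by move->; exists 1 => //; apply: HaltsLater => //; apply: HaltsNow. Qed.

Lemma runs_seq p q T T1 T2 n m :
  runs p T T1 n -> runs q T1 T2 m -> runs (p ;; q) T T2 (n + m).+1.
Proof.
move=> [n' le_n hp] [m' le_m hq]; exists (n' + m').+1; first by lia.
have inr_halts s T0 k T' : halts s T0 k T' ->
    @halts (seq_prog p q) (inr s) T0 k T'.
  elim=> [s0 U e|s0 U s1 a j U' e _ IH]; first by apply: HaltsNow; rewrite /= e.
  by apply: (@HaltsLater (seq_prog p q) _ _ (inr s1) a) IH; rewrite /= e.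
rewrite /=; elim: hp hq => {n' le_n T T1} [s U e|s U s1 a j U' e _ IH] hq.
  apply: (@HaltsLater (seq_prog p q) _ _ (inr (pstart q)) idle).
    by rewrite /= e.
  by rewrite act4_idle; apply: inr_halts.
by apply: (@HaltsLater (seq_prog p q) _ _ (inl s1) a); [rewrite /= e | exact: IH].
Qed.

Lemma runs_if_false (b : four cell -> bool) p T : ~~ b (scan T) -> runs (if_prog b p) T T 0.
Proof. by move=> nb; exists 0 => //; apply: HaltsNow; rewrite /= (negbTE nb). Qed.

Lemma runs_if_true (b : four cell -> bool) p T T' n :
  b (scan T) -> runs p T T' n -> runs (if_prog b p) T T' n.+1.
Proof.
move=> bT [m le_m hp]; exists m.+1 => //.
apply: (@HaltsLater (if_prog b p) _ _ (Some (pstart p)) idle); first by rewrite /= bT.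
rewrite act4_idle.
elim: hp => [s0 U e|s0 U s1 a j U' e _ IH]; first by apply: HaltsNow; rewrite /= e.
by apply: (@HaltsLater (if_prog b p) _ _ (Some s1) a) IH; rewrite /= e.
Qed.

Lemma runs_while_false (b : four cell -> bool) p T : ~~ b (scan T) -> runs (while_prog b p) T T 0.
Proof. by move=> nb; exists 0 => //; apply: HaltsNow; rewrite /= (negbTE nb). Qed.

Lemma runs_while_true (b : four cell -> bool) p T T1 T2 n m :
  b (scan T) -> runs p T T1 n -> runs (while_prog b p) T1 T2 m ->
  runs (while_prog b p) T T2 (n + m).+2.
Proof.
move=> bT [n' le_n hp] [m' le_m hw]; exists (n' + m').+2; first by lia.
apply: (@HaltsLater (while_prog b p) _ _ (Some (pstart p)) idle); first by rewrite /= bT.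
rewrite act4_idle {bT}; rewrite /= in hw.
elim: hp hw => [s0 U e|s0 U s1 a j U' e _ IH] hw.
  apply: (@HaltsLater (while_prog b p) _ _ None idle); first by rewrite /= e.
  by rewrite act4_idle.
by apply: (@HaltsLater (while_prog b p) _ _ (Some s1) a) (IH hw); rewrite /= e.
Qed.

Definition resolve (c : cell) (a : action) : cell * direction :=
  if a is Put c' d then (c', d) else (c, Stay).

Definition read4 (v : 4.-tuple cell) : four cell :=
  Four (nth None v 0) (nth None v 1) (nth None v 2) (nth None v 3).

Definition instructions (v : four cell) (a : four action) :
    4.-tuple (cell * direction) :=
  [tuple of mkseq (fun j => resolve (get4 j v) (get4 j a)) 4].

(** The first tape is the input tape and the last one the output tape of the
    machine. *)
Definition to_machine (p : prog) : machine :=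
  @Machine 3 (pstate p) (pstart p) (fun s v =>
    omap (fun x => (x.1, instructions (read4 v) x.2)) (pdelta s (read4 v))).

(** Machine tapes agree with program tapes only up to trailing blanks. *)
Definition same_tape (t u : tape) : Prop :=
  (forall k, nth None (tape_left t) k = nth None (tape_left u) k) /\
  (forall k, nth None (tape_right t) k = nth None (tape_right u) k).

Lemma same_scanned t u : same_tape t u -> scanned t = scanned u.
Proof. by case=> _ /(_ 0); rewrite /scanned -!nth0. Qed.

Lemma nth_push c s k : nth None (push c s) k = nth None (c :: s) k.
Proof. by case: c s k => [b|] [|x s] [|k] //=; rewrite nth_nil. Qed.

Lemma same_act t u a : same_tape t u ->
  same_tape (write_move t (resolve (scanned t) a)) (act u a).
Proof.
case: t u => l r [l' r'] [/= el er].
have hl k : nth None (behead l) k = nth None (behead l') k.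
  by rewrite !nth_behead.
have hr k : nth None (behead r) k = nth None (behead r') k.
  by rewrite !nth_behead.
have hl0 : head None l = head None l' by rewrite -!nth0.
have hr0 : head None r = head None r' by rewrite -!nth0.
case: a => [|c [||]] /=; rewrite /scanned /=; split=> k //=.
all: rewrite ?nth_push; case: k => [|k] //=.
all: rewrite ?nth_push ?hr0 //; try by case: k => [|k] /=.
all: by rewrite -er -nth_behead.
Qed.

Definition simulates (p : prog) (c : config (to_machine p)) (T : four tape) : Prop :=
  forall j : 'I_4, same_tape (cfg_tapes c j) (get4 j T).

Lemma halts_simulated p (s : pstate p) T n T' : halts s T n T' ->
  forall c : config (to_machine p), cfg_state c = s -> simulates c T ->
  halted (iter n (@step (to_machine p)) c) /\
  simulates (iter n (@step (to_machine p)) c) T'.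
Proof.
have read_scan (c : config (to_machine p)) U : simulates c U ->
    read4 [tuple scanned (cfg_tapes c i) | i < 4] = scan U.
  move=> sim; have e j (lt_j : j < 4) :
      nth None [tuple scanned (cfg_tapes c i) | i < 4] j = get4 j (scan U).
    rewrite -[j]/(nat_of_ord (Ordinal lt_j)) -tnth_nth tnth_mktuple.
    by rewrite get_scan; apply: same_scanned.
  by rewrite /read4 !e //; case: (U).
elim=> [s0 U e|s0 U s1 a j U' e _ IH] c es sim.
  split=> //=; rewrite /halted /transition /=.
  by rewrite (read_scan _ _ sim) es e.
rewrite iterSr; apply: IH.
  by rewrite /step /transition /= (read_scan _ _ sim) es e.
move=> i; rewrite /step /transition /= (read_scan _ _ sim) es e /=.
rewrite (tnth_nth (None, Stay)) /= nth_mkseq // get_scan.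
rewrite -(same_scanned (sim i)).
have -> : get4 i (act4 U a) = act (get4 i U) (get4 i a).
  by case: (U) => ? ? ? ?; case: (a) => ? ? ? ?; case: i => [[|[|[|[|]]]]].
exact: same_act.
Qed.

Lemma blank_free_same s s' :
  (forall k, nth None s k = nth None s' k) ->
  blank_free_prefix s = blank_free_prefix s'.
Proof.
have nil_case u : (forall k, nth None u k = None) -> blank_free_prefix u = [::].
  by case: u => [|[b|] u] // /(_ 0).
elim: s s' => [|x s IH] s' e; first by rewrite [RHS]nil_case // => k; rewrite -e nth_nil.
case: s' e => [|y s'] e; first by rewrite [LHS]nil_case // => k; rewrite e nth_nil.
have := e 0; rewrite /= => ->; case: y {e} (fun k => e k.+1) => [b|] //= e.
by rewrite (IH s').
Qed.

Lemma blank_free_map_some w : blank_free_prefix (map Some w) = w.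
Proof. by elim: w => //= b w ->. Qed.

(** The head scans the first symbol of [v], or the blank after [u] if [v] is
    empty; in particular [zipper o [::]] is a tape on which [o] was written. *)
Definition zipper (u v : seq bool) : tape :=
  Tape (map Some (rev u)) (map Some v).

(** A halted machine no longer changes, so an upper bound on the running time
    suffices although the definition prescribes an exact number of steps. *)
Lemma polytime_of_runs (P Q : problem) (p : prog) (c d : nat)
    (f : instance P -> instance Q) :
  (forall x : instance P, exists t0 t1 t2,
      runs p (Four (zipper [::] (encode x)) blank_tape blank_tape blank_tape)
        (Four t0 t1 t2 (zipper [::] (encode (f x))))
        (c * size (encode x) ^ d + c)) ->
  polytime f.
Proof.
move=> run_f; exists (to_machine p), c, d => x.
have [t0 [t1 [t2 [n le_n hn]]]] := run_f x.
have sim0 : simulates (@initial (to_machine p) (encode x))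
    (Four (zipper [::] (encode x)) blank_tape blank_tape blank_tape).
  by case=> [[|[|[|[|]]]]] //=.
have [] := @halts_simulated _ _ _ _ _ hn (initial (to_machine p) (encode x)) erefl sim0.
set c1 := iter n _ _ => halt1 sim1.
rewrite /computes_within -(subnK le_n) iterD -/c1.
have -> : iter (c * size (encode x) ^ d + c - n) (@step (to_machine p)) c1 = c1.
  elim: (_ - _) => //= j ->; move: halt1.
  by rewrite /halted /step; case: (transition c1).
split=> //; rewrite /output; have [_ /blank_free_same ->] := sim1 ord_max.
by rewrite /= blank_free_map_some.
Qed.

Definition go (j : nat) (d : direction) : prog :=
  do_prog (fun v => set4 j idle (Put (get4 j v) d)).

Definition write (j : nat) (b : bool) (d : direction) : prog :=
  do_prog (fun v => set4 j idle (Put (Some b) d)).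

Definition nonblank (j : nat) (v : four cell) : bool := isSome (get4 j v).

Definition reads (j : nat) (b : bool) (v : four cell) : bool :=
  get4 j v == Some b.

(** The initial move takes the head off the blank at the end of a fully scanned
    tape, where the loop would otherwise stop at once. *)
Definition rewind (j : nat) : prog :=
  go j MoveLeft ;; while_prog (nonblank j) (go j MoveLeft) ;; go j MoveRight.

(** Appends tape [j] to the output and replaces each of its bits by [e] of it. *)
Definition dump (j : nat) (e : bool -> bool) : prog :=
  while_prog (nonblank j)
    (do_prog (fun v => set4 3 (set4 j idle (Put (omap e (get4 j v)) MoveRight))
                         (Put (get4 j v) MoveRight))) ;;
  rewind j.

Lemma act_right u b v c :
  act (zipper u (b :: v)) (Put (Some c) MoveRight) = zipper (rcons u c) v.
Proof. by rewrite /zipper rev_rcons. Qed.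

Lemma act_stay u b v c :
  act (zipper u (b :: v)) (Put (Some c) Stay) = zipper u (c :: v).
Proof. by []. Qed.

Lemma act_append u c :
  act (zipper u [::]) (Put (Some c) MoveRight) = zipper (rcons u c) [::].
Proof. by rewrite /zipper rev_rcons. Qed.

Lemma act_left u a b v c :
  act (zipper (rcons u a) (b :: v)) (Put (Some c) MoveLeft) =
  zipper u [:: a, c & v].
Proof. by rewrite /zipper rev_rcons. Qed.

Lemma runs_go j d T :
  runs (go j d) T (set4 j T (act (get4 j T) (Put (scanned (get4 j T)) d))) 1.
Proof. by apply: runs_do; rewrite act4_set4 get_scan. Qed.

Lemma runs_write j b d T :
  runs (write j b d) T (set4 j T (act (get4 j T) (Put (Some b) d))) 1.
Proof. by apply: runs_do; rewrite act4_set4. Qed.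

Lemma runs_rewind j T u v : get4 j T = zipper u v ->
  runs (rewind j) T (set4 j T (zipper [::] (u ++ v))) (3 * size u + 4).
Proof.
(* The head is on the blank to the left of the word. *)
move=> eT; set before := fun w : seq bool => Tape [::] (push None (map Some w)).
have loop u' b v' : runs (while_prog (nonblank j) (go j MoveLeft))
    (set4 j T (zipper u' (b :: v'))) (set4 j T (before (u' ++ b :: v')))
    (3 * (size u').+1).
  elim/last_ind: u' b v' => [|u' a IH] b v'.
    apply: (runs_le _ (runs_while_true _ (runs_go _ _ _) _)); last first.
    - rewrite get_set4 set4_set4; apply: runs_while_false.
      by rewrite /nonblank get_scan get_set4.
    - by rewrite /nonblank get_scan get_set4.
    by [].
  apply: (runs_le _ (runs_while_true _ (runs_go _ _ _) _)); last first.
  - by rewrite get_set4 set4_set4 act_left -cats1 -catA; apply: IH.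
  - by rewrite /nonblank get_scan get_set4.
  by rewrite size_rcons; lia.
have right w : runs (go j MoveRight) (set4 j T (before w))
    (set4 j T (zipper [::] w)) 1.
  have := runs_go j MoveRight (set4 j T (before w)).
  by rewrite get_set4 set4_set4; case: w => [|a w].
have left : runs (go j MoveLeft) T _ 1 := runs_go j MoveLeft T.
rewrite eT in left; case/lastP: u eT left => [|u a] eT left.
  have first : runs (while_prog (nonblank j) (go j MoveLeft))
      (set4 j T (before v)) (set4 j T (before v)) 0.
    by apply: runs_while_false; rewrite /nonblank get_scan get_set4; case: (v).
  apply: (runs_le _ (runs_seq left (runs_seq _ (right _)))); last first.
  - by case: v {eT} left first => [|b v] left; exact.
  by [].
apply: (runs_le _ (runs_seq left (runs_seq _ (right _)))); last first.
  have -> : act (zipper (rcons u a) v) (Put (scanned (zipper (rcons u a) v)) MoveLeft)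
      = zipper u (a :: v).
    by case: (v) => [|b v']; [rewrite /zipper rev_rcons | rewrite act_left].
  by rewrite -cats1 -catA; apply: loop.
by rewrite size_rcons; lia.
Qed.

Lemma runs_dump j e T v o : j < 3 ->
  get4 j T = zipper [::] v -> get4 3 T = zipper o [::] ->
  runs (dump j e) T (set4 3 (set4 j T (zipper [::] (map e v))) (zipper (o ++ v) [::]))
    (6 * size v + 5).
Proof.
move=> lt_j ej eo.
have act4_set2 U a b : act4 U (set4 3 (set4 j idle a) b) =
    set4 3 (set4 j U (act (get4 j U) a)) (act (get4 3 U) b).
  by case: U; case: j lt_j {ej} => [|[|[|]]].
have set_swap x y x' y' : set4 3 (set4 j (set4 3 (set4 j T x) y) x') y' =
    set4 3 (set4 j T x') y'.
  by case: T {ej eo}; case: j lt_j act4_set2 => [|[|[|]]].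
have set_back x y z : set4 j (set4 3 (set4 j T x) y) z = set4 3 (set4 j T z) y.
  by case: T {ej eo set_swap}; case: j lt_j act4_set2 => [|[|[|]]].
have get3 U x : get4 3 (set4 j U x) = get4 3 U.
  by case: U; case: j lt_j {ej act4_set2 set_swap set_back} => [|[|[|]]].
have getj U x : get4 j (set4 3 U x) = get4 j U.
  by case: U; case: j lt_j {ej act4_set2 set_swap get3 set_back} => [|[|[|]]].
have loop u w o' : runs (while_prog (nonblank j)
    (do_prog (fun v => set4 3 (set4 j idle (Put (omap e (get4 j v)) MoveRight))
                         (Put (get4 j v) MoveRight))))
    (set4 3 (set4 j T (zipper u w)) (zipper o' [::]))
    (set4 3 (set4 j T (zipper (u ++ map e w) [::])) (zipper (o' ++ w) [::]))
    (3 * size w).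
  elim: w u o' => [|b w IH] u o'.
    rewrite !cats0; apply: runs_while_false.
    by rewrite /nonblank get_scan getj get_set4.
  apply: (runs_le _ (runs_while_true _ (runs_do (erefl _)) _)); last first.
  - rewrite !get_scan getj get_set4.
    rewrite act4_set2 getj !get_set4 act_right act_append.
    by rewrite set_swap -!cat_rcons; apply: IH.
  - by rewrite /nonblank get_scan getj get_set4.
  by rewrite /=; lia.
have eT : T = set4 3 (set4 j T (zipper [::] v)) (zipper o [::]).
  by rewrite -ej set4_get -eo set4_get.
rewrite {1}eT; apply: (runs_le _ (runs_seq (loop _ _ _) _)); last first.
  have := @runs_rewind j (set4 3 (set4 j T (zipper (map e v) [::])) (zipper (o ++ v) [::])).
  move/(_ (map e v) [::]); rewrite getj get_set4 cats0 => /(_ (erefl _)).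
  by rewrite set_back size_map; exact.
by lia.
Qed.

Arguments zipper : simpl never.
Arguments act : simpl never.

Lemma runs_dump1 e i v p o :
  runs (dump 1 e) (Four i (zipper [::] v) p (zipper o [::]))
    (Four i (zipper [::] (map e v)) p (zipper (o ++ v) [::])) (6 * size v + 5).
Proof. exact: (@runs_dump 1 e (Four i _ p _)). Qed.

Lemma runs_dump2 e i v p o :
  runs (dump 2 e) (Four i p (zipper [::] v) (zipper o [::]))
    (Four i p (zipper [::] (map e v)) (zipper (o ++ v) [::])) (6 * size v + 5).
Proof. exact: (@runs_dump 2 e (Four i p _ _)). Qed.

Lemma runs_eq p T T1 T2 n : runs p T T1 n -> T1 = T2 -> runs p T T2 n.
Proof. by move=> h <-. Qed.

(** Symbolic execution of a sequence: the first program is run by [lem], and the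
    tapes it leaves are simplified before the rest is run. *)
Ltac run_first lem :=
  eapply runs_seq; [apply: lem | rewrite /= ?act_right ?act_append ?act_left ?act_stay].

Ltac run_last lem := eapply runs_eq; [apply: lem | rewrite /=].

Ltac first_rewind :=
  eapply runs_seq; [eapply runs_rewind; reflexivity | rewrite /=].

Ltac last_rewind :=
  eapply runs_eq; [eapply runs_rewind; reflexivity | rewrite /=].

(** * The program from CNF pairs to structures *)

(** Every input bit that is consumed adds one row to the incidence matrix: the
    final bit of a clause adds the row of that clause, and every other bit the
    padding row on tape 2. The number of rows is thus the length of the input,
    which is also the length of a row, without any counting. *)
Definition next : prog := go 0 MoveRight ;; dump 2 id.

(** The row of the current clause is collected on tape 1. Its first two
    positions stand for the fresh variables y and z, hence the two moves to the
    right before the unary index is followed. *)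
Definition parse_clause : prog :=
  while_prog (reads 0 true)
    (next ;; go 1 MoveRight ;; go 1 MoveRight ;;
     while_prog (reads 0 true) (next ;; go 1 MoveRight) ;;
     next ;; write 1 true Stay ;; rewind 1).

(** The clauses of the first CNF receive y, those of the second one z. *)
Definition mark_side (m : bool) : prog :=
  if m then go 1 MoveRight ;; write 1 true MoveLeft else write 1 true Stay.

Definition parse_cnf (m : bool) : prog :=
  while_prog (reads 0 true)
    (next ;; parse_clause ;; go 0 MoveRight ;; mark_side m ;;
     dump 1 (fun=> false)) ;;
  next.

(** Writes the domain size in unary, which is the length of the input, and the
    empty unary relation; tape 1 becomes an empty row and tape 2 the padding
    row, which contains exactly y and z. *)
Definition init_cnf : prog :=
  while_prog (nonblank 0)
    (do_prog (fun v => Four (Put (get4 0 v) MoveRight) (Put (Some false) MoveRight)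
                            (Put (Some false) MoveRight) (Put (Some true) MoveRight))) ;;
  write 3 false MoveRight ;; rewind 0 ;; rewind 1 ;; rewind 2 ;;
  write 2 true MoveRight ;; write 2 true MoveLeft ;; dump 1 id.

Definition cnf_to_structure : prog :=
  init_cnf ;; (while_prog (reads 0 true) next ;; next) ;;
  parse_cnf false ;; parse_cnf true ;; rewind 3.

Notation nat_cnf := (seq (seq nat)).

Section CnfToStructure.

Variable N : nat.
Hypothesis N_gt1 : 1 < N.

(* A generous bound on the time spent on one input bit. *)
Let K := 100 * N + 100.

Definition bits (p : nat -> bool) : seq bool := mkseq p N.

Definition pad_row : seq bool := bits (fun k => k < 2).

(** The contents of tape 1 when the members [c] of a clause have been read. *)
Definition buffer (c : seq nat) : seq bool :=
  bits (fun k => (1 < k) && (k - 2 \in c)).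

Definition clause_row (m : bool) (c : seq nat) : seq bool :=
  bits (fun k => if k < 2 then k == m else k - 2 \in c).

Lemma runs_next u b v B o :
  runs next (Four (zipper u (b :: v)) B (zipper [::] pad_row) (zipper o [::]))
    (Four (zipper (rcons u b) v) B (zipper [::] pad_row)
      (zipper (o ++ pad_row) [::])) (6 * N + 10).
Proof.
apply: (runs_le _ (runs_seq (runs_go _ _ _) _)); last first.
  rewrite /= act_right.
  have := runs_dump2 id (zipper (rcons u b) v) pad_row B o.
  by rewrite map_id; exact.
by rewrite size_mkseq; lia.
Qed.

Definition pads (n : nat) : seq bool := flatten (nseq n pad_row).

Local Arguments pads : simpl never.

Lemma padsD n m : pads n ++ pads m = pads (n + m).
Proof. by rewrite /pads nseqD flatten_cat. Qed.

Lemma pads1 : pads 1 = pad_row.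
Proof. exact: cats0. Qed.

Lemma runs_header n u v B o :
  runs (while_prog (reads 0 true) next)
    (Four (zipper u (nseq n true ++ false :: v)) B (zipper [::] pad_row) (zipper o [::]))
    (Four (zipper (u ++ nseq n true) (false :: v)) B (zipper [::] pad_row)
      (zipper (o ++ pads n) [::])) (n * K).
Proof.
elim: n u o => [|n IH] u o.
  by rewrite !cats0; apply: runs_while_false.
apply: (runs_le _ (runs_while_true _ (runs_next _ _ _ _ _) _)) => //; last first.
  by have := IH (rcons u true) (o ++ pad_row); rewrite cat_rcons -catA; apply.
by rewrite /K; lia.
Qed.

Lemma runs_index n u v ub vb o : size vb >= n ->
  runs (while_prog (reads 0 true) (next ;; go 1 MoveRight))
    (Four (zipper u (nseq n true ++ false :: v)) (zipper ub vb)
      (zipper [::] pad_row) (zipper o [::]))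
    (Four (zipper (u ++ nseq n true) (false :: v)) (zipper (ub ++ take n vb) (drop n vb))
      (zipper [::] pad_row)
      (zipper (o ++ pads n) [::])) (n * K).
Proof.
elim: n u o ub vb => [|n IH] u o ub vb le_n.
  by rewrite take0 drop0 !cats0; apply: runs_while_false.
case: vb le_n => // b vb le_n.
apply: (runs_le _ (runs_while_true _
  (runs_seq (runs_next _ _ _ _ _) (runs_go _ _ _)) _)) => //; last first.
  rewrite /= act_right.
  by have := IH (rcons u true) (o ++ pad_row) (rcons ub b) vb le_n;
     rewrite !cat_rcons -catA; apply.
by rewrite /K; lia.
Qed.

Lemma buffer_mark c i : i + 2 < N ->
  let s := buffer c in
  take (i + 2) s ++ true :: drop (i + 3) s = buffer (rcons c i).
Proof.
move=> lt_i s; have sz : size s = N by rewrite size_mkseq.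
have -> : take (i + 2) s ++ true :: drop (i + 3) s = set_nth false s (i + 2) true.
  by rewrite set_nthE sz lt_i addn3 addn2.
apply: (@eq_from_nth _ false); first by rewrite size_set_nth sz size_mkseq; lia.
move=> k; rewrite size_set_nth sz => lt_k.
rewrite nth_set_nth /= !nth_mkseq; try lia.
rewrite mem_rcons inE; case: eqP => [->|ne]; first by rewrite addnK eqxx; lia.
by case: (k - 2 =P i) => // e; case: ltnP => //; lia.
Qed.

Lemma runs_parse_var c i u v o : i + 2 < N ->
  runs (next ;; go 1 MoveRight ;; go 1 MoveRight ;;
     while_prog (reads 0 true) (next ;; go 1 MoveRight) ;;
     next ;; write 1 true Stay ;; rewind 1)
    (Four (zipper u (true :: encode_nat i ++ v)) (zipper [::] (buffer c))
      (zipper [::] pad_row) (zipper o [::]))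
    (Four (zipper (u ++ true :: encode_nat i) v) (zipper [::] (buffer (rcons c i)))
      (zipper [::] pad_row) (zipper (o ++ pads i.+2) [::])) (i.+1 * K).
Proof.
move=> lt_i; rewrite -buffer_mark //; have: size (buffer c) = N by rewrite size_mkseq.
case: (buffer c) => [|b0 [|b1 s]] /= sz; try lia.
rewrite /encode_nat cat_rcons.
eapply runs_le; last first.
  run_first runs_next.
  run_first runs_go.
  run_first runs_go.
  run_first runs_index; first by lia.
  run_first runs_next.
  rewrite addn2 addn3 /= (drop_nth false) ; last by lia.
  run_first runs_write.
  last_rewind.
  congr (Four (zipper _ v) (zipper _ _) _ (zipper _ _)).
  - by rewrite cat_rcons rcons_cat.
  - by rewrite -!catA -pads1 !padsD addn1.
by rewrite /= size_take; case: (ltnP i (size s)); rewrite /K; lia.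
Qed.

(** The code of a clause without its terminating bit, which is treated
    separately because it triggers the output of the row. *)
Definition members (c : seq nat) : seq bool :=
  flatten [seq true :: encode_nat i | i <- c].

(** The indices of a clause still fit into a row after being shifted by two. *)
Definition small (c : seq nat) : bool := all (fun i => i + 2 < N) c.

Lemma runs_parse_clause p c u v o : small c ->
  runs parse_clause
    (Four (zipper u (members c ++ false :: v)) (zipper [::] (buffer p))
      (zipper [::] pad_row) (zipper o [::]))
    (Four (zipper (u ++ members c) (false :: v)) (zipper [::] (buffer (p ++ c)))
      (zipper [::] pad_row) (zipper (o ++ pads (size (members c))) [::]))
    (size (members c) * K).
Proof.
elim: c p u o => [|i c IH] p u o.
  by rewrite !cats0 => _; apply: runs_while_false.
case/andP=> lt_i small_c; rewrite /members /= -/(members c).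
eapply runs_le; last first.
  eapply runs_while_true => //.
    by rewrite -catA; apply: runs_parse_var.
  run_last IH => //.
  congr (Four (zipper _ _) (zipper _ (buffer _)) _ (zipper _ _)).
  - by rewrite -catA.
  - by rewrite cat_rcons.
  by rewrite -catA padsD /= size_cat size_rcons size_nseq.
by rewrite /= size_cat size_rcons size_nseq /K; lia.
Qed.

Definition clauses_code (phi : nat_cnf) : seq bool :=
  flatten [seq true :: encode_seq encode_nat c | c <- phi].

Local Arguments clauses_code : simpl never.

Lemma clauses_codeS c phi :
  clauses_code (c :: phi) = true :: members c ++ false :: clauses_code phi.
Proof. by rewrite /clauses_code /= /encode_seq cat_rcons. Qed.

Definition clause_rows (m : bool) (c : seq nat) : seq bool :=
  pads (size (members c)).+1 ++ clause_row m c.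

Lemma runs_mark_side m i p t c :
  runs (mark_side m) (Four i (zipper [::] (buffer c)) p t)
    (Four i (zipper [::] (clause_row m c)) p t) 3.
Proof.
have sz: size (buffer c) = N by rewrite size_mkseq.
have -> : clause_row m c = set_nth false (buffer c) m true.
  apply: (@eq_from_nth _ false).
    by rewrite size_set_nth sz size_mkseq; case: (m); lia.
  move=> k; rewrite size_mkseq => lt_k; rewrite nth_set_nth /= !nth_mkseq //.
  by case: ltnP; case: eqP => // ->; case: (m).
case: (buffer c) sz => [|b0 [|b1 s]] /= sz; try lia.
case: m => /=; last by apply: runs_le (runs_write _ _ _ _).
eapply runs_le; last first.
  run_first runs_go.
  run_last runs_write.
  by rewrite -[[:: b0]]/(rcons [::] b0) act_left.
by [].
Qed.

Lemma runs_parse_cnf m phi u v o : all small phi ->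
  runs (parse_cnf m)
    (Four (zipper u (encode_seq (encode_seq encode_nat) phi ++ v))
      (zipper [::] (bits (fun=> false))) (zipper [::] pad_row) (zipper o [::]))
    (Four (zipper (u ++ encode_seq (encode_seq encode_nat) phi) v)
      (zipper [::] (bits (fun=> false))) (zipper [::] pad_row)
      (zipper (o ++ flatten [seq clause_rows m c | c <- phi] ++ pad_row) [::]))
    ((size (encode_seq (encode_seq encode_nat) phi)).+1 * K).
Proof.
rewrite -[encode_seq _ phi]/(rcons (clauses_code phi) false) => small_phi.
eapply runs_le; last first.
  eapply runs_seq.
    have loop u' o' : runs (while_prog (reads 0 true)
        (next ;; parse_clause ;; go 0 MoveRight ;; mark_side m ;;
         dump 1 (fun=> false)))
      (Four (zipper u' (clauses_code phi ++ false :: v)) (zipper [::] (bits (fun=> false)))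
         (zipper [::] pad_row) (zipper o' [::]))
      (Four (zipper (u' ++ clauses_code phi) (false :: v)) (zipper [::] (bits (fun=> false)))
         (zipper [::] pad_row)
         (zipper (o' ++ flatten [seq clause_rows m c | c <- phi]) [::]))
      (size (clauses_code phi) * K).
      elim: phi small_phi u' o' => [_ u' o'|c phi IH /andP[small_c small_phi] u' o'].
        by rewrite !cats0; apply: runs_while_false.
      rewrite clauses_codeS cat_cons -[(members c ++ _) ++ _]catA cat_cons.
      eapply runs_le; last first.
        eapply runs_while_true => //.
          run_first runs_next.
          have -> : bits (fun=> false) = buffer [::].
            by apply: eq_mkseq => k; rewrite andbF.
          run_first runs_parse_clause => //.
          run_first runs_go.
          run_first runs_mark_side.
          apply: runs_dump1.
        have -> : [seq false | _ <- clause_row m c] = bits (fun=> false).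
          by rewrite /bits /mkseq -map_comp.
        run_last IH => //.
        congr (Four (zipper _ _) _ _ (zipper _ _)).
        - by rewrite -!cats1 -!catA.
        - by rewrite /clause_rows /= -!catA.
      rewrite /= size_cat /= size_mkseq /K; lia.
    by rewrite cat_rcons; apply: loop.
  run_last runs_next.
  by congr (Four (zipper _ _) _ _ (zipper _ _)); rewrite ?rcons_cat // -!catA.
by rewrite size_rcons /K; lia.
Qed.

Lemma runs_init w : size w = N ->
  runs init_cnf
    (Four (zipper [::] w) blank_tape blank_tape blank_tape)
    (Four (zipper [::] w) (zipper [::] (bits (fun=> false))) (zipper [::] pad_row)
      (zipper (encode_nat N ++ bits (fun=> false)) [::])) K.
Proof.
move=> sz.
have loop u v : size v + size u = N -> runs (while_prog (nonblank 0)
    (do_prog (fun v => Four (Put (get4 0 v) MoveRight) (Put (Some false) MoveRight)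
                         (Put (Some false) MoveRight) (Put (Some true) MoveRight))))
    (Four (zipper u v) (zipper (nseq (size u) false) [::])
      (zipper (nseq (size u) false) [::]) (zipper (nseq (size u) true) [::]))
    (Four (zipper (u ++ v) [::]) (zipper (nseq N false) [::])
      (zipper (nseq N false) [::]) (zipper (nseq N true) [::])) (3 * size v).
  elim: v u => [|b v IH] u sz_uv.
    by rewrite cats0 -sz_uv; apply: runs_while_false.
  eapply runs_le; last first.
    eapply runs_while_true => //; first exact: runs_do.
    rewrite /= act_right !act_append -cat_rcons.
    have nseq_rcons (c : bool) : rcons (nseq (size u) c) c = nseq (size (rcons u b)) c.
      by rewrite size_rcons -cats1 -(nseqD _ 1) addn1.
    rewrite !nseq_rcons; apply: IH; rewrite size_rcons -sz_uv /=; lia.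
  by rewrite /=; lia.
have -> : pad_row = [:: true, true & nseq (N - 2) false].
  apply: (@eq_from_nth _ false); first by rewrite size_mkseq /= size_nseq; lia.
  move=> k; rewrite size_mkseq => lt_k; rewrite nth_mkseq //.
  by case: k {lt_k} => [|[|k]] //=; rewrite nth_nseq if_same.
have bits0 : bits (fun=> false) = nseq N false.
  apply: (@eq_from_nth _ false); first by rewrite size_mkseq size_nseq.
  by move=> k; rewrite size_mkseq => lt_k; rewrite nth_mkseq // nth_nseq if_same.
eapply runs_le; last first.
  eapply runs_seq.
    by apply: (loop [::] w); rewrite sz addn0.
  run_first runs_write.
  first_rewind; first_rewind; first_rewind; rewrite !cats0.
  have -> : nseq N false = [:: false, false & nseq (N - 2) false].
    by case: N N_gt1 => [|[|M]] // _; rewrite subn2.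
  run_first runs_write.
  run_first runs_write.
  rewrite -[[:: true]]/(rcons [::] true) act_left.
  run_last runs_dump1.
  rewrite map_id.
  have <- : nseq N false = [:: false, false & nseq (N - 2) false].
    by case: N N_gt1 => [|[|M]] // _; rewrite subn2.
  by rewrite bits0.
rewrite /= !size_nseq sz /K; lia.
Qed.

Definition cnf_rows (m : bool) (phi : nat_cnf) : seq bool :=
  flatten [seq clause_rows m c | c <- phi] ++ pad_row.

Lemma size_pads n : size (pads n) = n * N.
Proof.
by rewrite /pads size_flatten /shape map_nseq sumn_nseq size_mkseq mulnC.
Qed.

Lemma size_cnf_rows m phi :
  size (cnf_rows m phi) = size (encode_seq (encode_seq encode_nat) phi) * N.
Proof.
rewrite -[encode_seq _ phi]/(rcons (clauses_code phi) false) size_rcons.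
rewrite /cnf_rows size_cat size_mkseq mulSn addnC; congr (_ + _).
elim: phi => [//|c phi IH]; rewrite clauses_codeS map_cons.
rewrite -[flatten _]/(clause_rows m c ++ flatten [seq clause_rows m c | c <- phi]).
by rewrite size_cat IH /clause_rows size_cat size_pads size_mkseq -cat_cons size_cat /=; lia.
Qed.

Lemma size_encode_nat n : size (encode_nat n) = n.+1.
Proof. by rewrite size_rcons size_nseq. Qed.

Lemma runs_cnf_to_structure n f g :
  let w := encode_nat n ++ encode_seq (encode_seq encode_nat) f ++
           encode_seq (encode_seq encode_nat) g in
  size w = N -> all small f -> all small g ->
  exists t0 t1 t2,
  runs cnf_to_structure (Four (zipper [::] w) blank_tape blank_tape blank_tape)
    (Four t0 t1 t2 (zipper [::] (encode_nat N ++ bits (fun=> false) ++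
       pads n.+1 ++ cnf_rows false f ++ cnf_rows true g)))
   (500 * N ^ 2 + 500).
Proof.
move=> w sz small_f small_g.
have -> : pads n.+1 = pads n ++ pad_row by rewrite -pads1 padsD addn1.
do 3 eexists.
eapply runs_le; last first.
  eapply runs_seq; first exact: runs_init.
  eapply runs_seq.
    rewrite /w {1}/encode_nat cat_rcons.
    run_first runs_header.
    apply: runs_next.
  eapply runs_seq; first exact: runs_parse_cnf.
  rewrite -[X in Four (zipper _ X)]cats0.
  eapply runs_seq; first exact: runs_parse_cnf.
  (* The output is read from the head, which therefore returns to the first bit. *)
  last_rewind.
  rewrite cats0.
  congr (Four _ _ _ (zipper _ _)).
  by rewrite /cnf_rows -!catA.
rewrite -/(cnf_rows false f) -/(cnf_rows true g).
move: (size_cnf_rows false f) (size_cnf_rows true g).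
move: (cnf_rows false f) (cnf_rows true g) => rows_f rows_g sz_f sz_g.
rewrite !size_cat sz_f sz_g size_pads !size_mkseq size_encode_nat.
move: sz; rewrite /w !size_cat size_encode_nat /K.
move: (size _) (size _) => F G sz.
have : (n.+1 + (G + F)) * N = N * N by rewrite sz.
by rewrite expnS expn1; nia.
Qed.

End CnfToStructure.

(** * The program from structures to CNF pairs *)

Definition emit (b : bool) : prog := write 3 b MoveRight.

Definition emit_index : prog := emit true ;; dump 2 id ;; emit false.

(** Tape 2 holds the index of the current column in unary; it grows at its left
    end, so that its head is always in place for copying the index. *)
Definition increment : prog := go 2 MoveLeft ;; write 2 true Stay.

Definition clear_index : prog :=
  while_prog (nonblank 2)
    (do_prog (fun v => set4 2 idle (Put None MoveRight))).

(** The flag [m] selects the first CNF, whose clauses are enlarged by the forced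
    elements; these are on tape 1. *)
Definition bit_set (m : bool) (v : four cell) : bool :=
  reads 0 true v || m && reads 1 true v.

Definition emit_row (m : bool) : prog :=
  while_prog (nonblank 1)
    (if_prog (bit_set m) emit_index ;;
     go 0 MoveRight ;; go 1 MoveRight ;; increment) ;;
  rewind 1 ;; clear_index.

Definition emit_rows (m : bool) : prog :=
  while_prog (nonblank 0) (emit true ;; emit_row m ;; emit false).

Definition emit_units : prog :=
  while_prog (nonblank 1)
    (if_prog (reads 1 true) (emit true ;; emit_index ;; emit false) ;;
     go 1 MoveRight ;; increment).

(** The input is erased while it is read, so that the left end of tape 0 becomes
    the beginning of the incidence matrix, to which the second pass returns. *)
Definition init_structure : prog :=
  while_prog (reads 0 true)
    (do_prog (fun v => Four (Put None MoveRight) (Put (Some true) MoveRight)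
                            Keep (Put (Some true) MoveRight))) ;;
  do_prog (fun v => Four (Put None MoveRight) Keep Keep (Put (Some false) MoveRight)) ;;
  rewind 1 ;;
  while_prog (nonblank 1)
    (do_prog (fun v => Four (Put None MoveRight) (Put (get4 0 v) MoveRight) Keep Keep)) ;;
  rewind 1.

(** The matrix is read twice, once for each CNF of the pair. *)
Definition structure_to_cnf : prog :=
  init_structure ;; emit_rows true ;; emit false ;; rewind 0 ;;
  emit_rows false ;; emit_units ;; emit false ;; rewind 3.

Definition combine (m : bool) (r x : seq bool) : seq bool :=
  [seq p.1 || m && p.2 | p <- zip r x].

Fixpoint listing (i : nat) (bs : seq bool) : seq bool :=
  if bs is b :: bs' then
    (if b then true :: encode_nat i else [::]) ++ listing i.+1 bs'
  else [::].

Fixpoint unit_listing (i : nat) (bs : seq bool) : seq bool :=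
  if bs is b :: bs' then
    (if b then true :: encode_seq encode_nat [:: i] else [::]) ++ unit_listing i.+1 bs'
  else [::].

Definition rows_listing (m : bool) (rs : seq (seq bool)) (x : seq bool) : seq bool :=
  flatten [seq true :: rcons (listing 0 (combine m r x)) false | r <- rs].

Lemma runs_emit b t0 t1 t2 o :
  runs (emit b) (Four t0 t1 t2 (zipper o [::])) (Four t0 t1 t2 (zipper (rcons o b) [::])) 1.
Proof. by run_last runs_write; rewrite act_append. Qed.

Lemma runs_emit_index t0 t1 i o :
  runs emit_index (Four t0 t1 (zipper [::] (nseq i true)) (zipper o [::]))
    (Four t0 t1 (zipper [::] (nseq i true)) (zipper (o ++ true :: encode_nat i) [::]))
    (6 * i + 10).
Proof.
eapply runs_le; last first.
  run_first runs_emit.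
  eapply runs_seq; first exact: runs_dump2.
  run_last runs_emit; rewrite map_id.
  by rewrite cat_rcons rcons_cat.
by rewrite size_nseq; lia.
Qed.

Lemma runs_increment t0 t1 i o :
  runs increment (Four t0 t1 (zipper [::] (nseq i true)) o)
    (Four t0 t1 (zipper [::] (nseq i.+1 true)) o) 3.
Proof.
eapply runs_le; last first.
  run_first runs_go.
  by run_last runs_write; case: i.
by [].
Qed.

Lemma runs_clear_index t0 t1 v o :
  runs clear_index (Four t0 t1 (zipper [::] v) o) (Four t0 t1 blank_tape o)
    (3 * size v).
Proof.
elim: v => [|b v IH]; first exact: runs_while_false.
eapply runs_le; last first.
  by eapply runs_while_true; [|exact: runs_do|exact: IH].
by rewrite /=; lia.
Qed.

Lemma runs_emit_row_bits m r post pre xp xs i o N :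
  size r = size xs -> i + size r <= N ->
  runs (while_prog (nonblank 1)
    (if_prog (bit_set m) emit_index ;;
     go 0 MoveRight ;; go 1 MoveRight ;; increment))
   (Four (zipper pre (r ++ post)) (zipper xp xs) (zipper [::] (nseq i true))
     (zipper o [::]))
   (Four (zipper (pre ++ r) post) (zipper (xp ++ xs) [::])
     (zipper [::] (nseq (i + size r) true))
     (zipper (o ++ listing i (combine m r xs)) [::]))
   (size r * (6 * N + 30)).
Proof.
elim: r xs pre xp i o => [|b r IH] [|x xs] pre xp i o //= => [_|[sz]] le_N.
  by rewrite !cats0 addn0; apply: runs_while_false.
eapply runs_le; last first.
  eapply runs_while_true => //.
    eapply runs_seq.
      have emitted : runs (if_prog (bit_set m) emit_index)
          (Four (zipper pre (b :: r ++ post)) (zipper xp (x :: xs))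
            (zipper [::] (nseq i true)) (zipper o [::]))
          (Four (zipper pre (b :: r ++ post)) (zipper xp (x :: xs))
            (zipper [::] (nseq i true))
            (zipper (o ++ (if b || m && x then true :: encode_nat i else [::])) [::]))
          (6 * i + 11).
        have bE : bit_set m (scan (Four (zipper pre (b :: r ++ post)) (zipper xp (x :: xs))
            (zipper [::] (nseq i true)) (zipper o [::]))) = b || m && x.
          by rewrite /bit_set /reads; case: (b); case: (x).
        case: ifP bE => _ bE.
          by apply: runs_le (runs_if_true _ (runs_emit_index _ _ _ _)); [lia|].
        rewrite cats0; apply: runs_le (runs_if_false _ _); first by [].
        by rewrite bE.
      exact: emitted.
    run_first runs_go.
    run_first runs_go.
    exact: runs_increment.
  run_last IH => //; first by rewrite addSnnS.
  rewrite !cat_rcons addnS; congr (Four _ _ _ (zipper _ _)).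
  by rewrite -catA.
by lia.
Qed.

Lemma runs_emit_row m r post pre x o N : size r = N -> size x = N ->
  runs (emit_row m)
   (Four (zipper pre (r ++ post)) (zipper [::] x) blank_tape (zipper o [::]))
   (Four (zipper (pre ++ r) post) (zipper [::] x) blank_tape
     (zipper (o ++ listing 0 (combine m r x)) [::]))
   (N * (6 * N + 40) + 10).
Proof.
move=> sz_r sz_x.
eapply runs_le; last first.
  eapply runs_seq.
    by apply: (@runs_emit_row_bits m r post pre [::] x 0 o N); rewrite ?sz_r.
  first_rewind.
  by rewrite cats0; apply: runs_clear_index.
by rewrite size_nseq /= sz_r sz_x; lia.
Qed.

Lemma runs_emit_rows m rs pre x o N :
  0 < N -> all (fun r => size r == N) rs -> size x = N ->
  runs (emit_rows m)
   (Four (zipper pre (flatten rs)) (zipper [::] x) blank_tape (zipper o [::]))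
   (Four (zipper (pre ++ flatten rs) [::]) (zipper [::] x) blank_tape
     (zipper (o ++ rows_listing m rs x) [::]))
   (size rs * (N * (6 * N + 40) + 20)).
Proof.
move=> N_gt0 sz_rs sz_x; elim: rs sz_rs pre o => [|r rs IH] /= sz_rs pre o.
  by rewrite !cats0; apply: runs_while_false.
case/andP: sz_rs => /eqP sz_r sz_rs.
eapply runs_le; last first.
  eapply runs_while_true.
  - by case: r sz_r => [|b r] //= sz0; rewrite -sz0 in N_gt0.
  - run_first runs_emit.
    eapply runs_seq; first exact: (runs_emit_row m (flatten rs) pre _ sz_r sz_x).
    exact: runs_emit.
  - run_last IH => //.
    congr (Four (zipper _ _) _ _ (zipper _ _)); first by rewrite catA.
    by rewrite /rows_listing /= -!cats1 -!catA.
by lia.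
Qed.

Lemma runs_emit_units t0 xp xs i o N : i + size xs <= N ->
  runs emit_units
   (Four t0 (zipper xp xs) (zipper [::] (nseq i true)) (zipper o [::]))
   (Four t0 (zipper (xp ++ xs) [::]) (zipper [::] (nseq (i + size xs) true))
     (zipper (o ++ unit_listing i xs) [::]))
   (size xs * (6 * N + 40)).
Proof.
elim: xs xp i o => [|x xs IH] xp i o /= le_N.
  by rewrite !cats0 addn0; apply: runs_while_false.
eapply runs_le; last first.
  eapply runs_while_true => //.
    eapply runs_seq.
      have emitted : runs (if_prog (reads 1 true) (emit true ;; emit_index ;; emit false))
          (Four t0 (zipper xp (x :: xs)) (zipper [::] (nseq i true)) (zipper o [::]))
          (Four t0 (zipper xp (x :: xs)) (zipper [::] (nseq i true))
            (zipper (o ++ (if x then true :: encode_seq encode_nat [:: i] else [::])) [::]))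
          (6 * i + 20).
        case: x; last first.
          by rewrite cats0; apply: runs_le (runs_if_false _ _).
        eapply runs_le; last first.
          apply: runs_if_true => //.
          run_first runs_emit.
          run_first runs_emit_index.
          run_last runs_emit.
          by rewrite /encode_seq /= cats0 -!cats1 -!catA.
        by lia.
      exact: emitted.
    run_first runs_go.
    exact: runs_increment.
  run_last IH => //; first by rewrite addSnnS.
  rewrite !cat_rcons addnS; congr (Four _ _ _ (zipper _ _)).
  by rewrite -catA.
by lia.
Qed.

Lemma runs_init_structure N x e : size x = N ->
  runs init_structure
    (Four (zipper [::] (encode_nat N ++ x ++ e)) blank_tape blank_tape blank_tape)
    (Four (zipper [::] e) (zipper [::] x) blank_tape (zipper (encode_nat N) [::]))
    (12 * N + 20).
Proof.
move=> sz.
have header k j : runs (while_prog (reads 0 true)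
    (do_prog (fun v => Four (Put None MoveRight) (Put (Some true) MoveRight)
                            Keep (Put (Some true) MoveRight))))
    (Four (zipper [::] (nseq k true ++ false :: x ++ e)) (zipper (nseq j true) [::])
      blank_tape (zipper (nseq j true) [::]))
    (Four (zipper [::] (false :: x ++ e)) (zipper (nseq (k + j) true) [::])
      blank_tape (zipper (nseq (k + j) true) [::])) (3 * k).
  elim: k j => [|k IH] j; first exact: runs_while_false.
  eapply runs_le; last first.
    eapply runs_while_true => //; first exact: runs_do.
    rewrite /= !act_append.
    have -> : rcons (nseq j true) true = nseq j.+1 true.
      by rewrite -cats1 -(nseqD _ 1) addn1.
    by have := IH j.+1; rewrite addnS; exact.
  by lia.
have fill v p w : size v = size w -> runs (while_prog (nonblank 1)
    (do_prog (fun v => Four (Put None MoveRight) (Put (get4 0 v) MoveRight) Keep Keep)))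
    (Four (zipper [::] (v ++ e)) (zipper p w) blank_tape (zipper (encode_nat N) [::]))
    (Four (zipper [::] e) (zipper (p ++ v) [::]) blank_tape (zipper (encode_nat N) [::]))
    (3 * size v).
  elim: v p w => [|b v IH] p [|c w] //= => [_|[sz_vw]].
    by rewrite cats0; apply: runs_while_false.
  eapply runs_le; last first.
    eapply runs_while_true => //; first exact: runs_do.
    by rewrite /= act_right -cat_rcons; apply: IH.
  by lia.
eapply runs_le; last first.
  rewrite {1}/encode_nat cat_rcons.
  run_first (header N 0); rewrite addn0.
  eapply runs_seq; first exact: runs_do.
  rewrite /= act_append.
  first_rewind; rewrite cats0.
  eapply runs_seq; first by apply: fill; rewrite size_nseq.
  by last_rewind; rewrite cats0.
by rewrite size_nseq /= sz; lia.
Qed.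

(** Bounds on the length of the output are needed for the time of the final
    [rewind]. *)
Lemma size_listing i bs N : i + size bs <= N -> size (listing i bs) <= size bs * N.+2.
Proof.
elim: bs i => //= b bs IH i le_N; rewrite size_cat mulSn leq_add //.
  by case: b => //=; rewrite size_encode_nat; lia.
by apply: IH; rewrite addSnnS.
Qed.

Lemma size_unit_listing i bs N :
  i + size bs <= N -> size (unit_listing i bs) <= size bs * N.+4.
Proof.
elim: bs i => //= b bs IH i le_N; rewrite size_cat mulSn leq_add //.
  by case: b => //=; rewrite size_rcons cats0 /= size_encode_nat; lia.
by apply: IH; rewrite addSnnS.
Qed.

Lemma size_rows_listing m rs x N :
  all (fun r => size r == N) rs -> size x = N ->
  size (rows_listing m rs x) <= size rs * (N * N.+2 + 2).
Proof.
move=> sz_rs sz_x; elim: rs sz_rs => //= r rs IH /andP[/eqP sz_r /IH {}IH].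
rewrite size_cat size_rcons -/(rows_listing m rs x).
have sz_c : size (combine m r x) = N by rewrite size_map size_zip sz_r sz_x minnn.
by have := @size_listing 0 (combine m r x) N; rewrite sz_c; lia.
Qed.

Lemma runs_structure_to_cnf N x rs w :
  0 < N -> size x = N -> size rs = N -> all (fun r => size r == N) rs ->
  w = encode_nat N ++ x ++ flatten rs ->
  exists t0 t1 t2,
  runs structure_to_cnf (Four (zipper [::] w) blank_tape blank_tape blank_tape)
    (Four t0 t1 t2 (zipper [::] (encode_nat N ++
       rcons (rows_listing true rs x) false ++
       rcons (rows_listing false rs x ++ unit_listing 0 x) false)))
    (1000 * size w ^ 3 + 1000).
Proof.
move=> N_gt0 sz_x sz_rs all_rs ->; do 3 eexists.
eapply runs_le; last first.
  eapply runs_seq; first exact: runs_init_structure.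
  eapply runs_seq; first exact: (runs_emit_rows _ _ _ N_gt0 all_rs sz_x).
  run_first runs_emit.
  first_rewind; rewrite cats0.
  eapply runs_seq; first exact: (runs_emit_rows _ _ _ N_gt0 all_rs sz_x).
  eapply runs_seq; first by apply: (@runs_emit_units _ [::] x 0 _ N); rewrite sz_x.
  run_first runs_emit.
  last_rewind.
  rewrite cats0; congr (Four _ _ _ (zipper _ _)).
  by rewrite -!cats1 -!catA.
rewrite !(size_encode_nat, size_cat, size_rcons) sz_x sz_rs.
have sz_flat : size (flatten rs) = N * N.
  rewrite size_flatten -{1}sz_rs; elim: rs all_rs {sz_rs} => //= r rs IH /andP[/eqP -> /IH ->].
  by rewrite mulSn.
rewrite sz_flat.
have := @size_rows_listing true rs x N all_rs sz_x.
have := @size_rows_listing false rs x N all_rs sz_x.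
have := @size_unit_listing 0 x N; rewrite sz_x sz_rs => /(_ (leqnn _)).
move: (size _) (size _) (size _) => a b c le_a le_b le_c.
have le3 : N * N * N <= (N.+1 + (N + N * N)) ^ 3.
  by rewrite !expnS expn0 muln1 mulnA !leq_mul //; lia.
have le2 : N * N <= N * N * N by rewrite leq_pmulr.
have le1 : N <= N * N by rewrite leq_pmulr.
move: (_ ^ 3) le3 => X le3.
nia.
Qed.

(** * The sentence *)

(** The symbol [true] is the unary relation that the guessed set has to contain,
    and [false] the binary incidence relation between clauses and variables;
    every element of the domain is both a clause and a variable. *)
Definition structure_sig : signature := @Signature bool (fun b => if b then 1 else 2).

Definition guess_sig : signature := @Signature unit (fun=> 1).

Notation full_sig := (sig_sum structure_sig guess_sig).

Definition incident (c i : nat) : formula full_sig :=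
  @FAtom full_sig (inl false) [tuple c; i].

Definition chosen (i : nat) : formula full_sig := @FAtom full_sig (inr tt) [tuple i].

Definition every_row_meets (P : formula full_sig) : formula full_sig :=
  FForall 0 (FExists 1 (FAnd (incident 0 1) P)).

Definition some_row_avoids (P : formula full_sig) : formula full_sig :=
  FExists 0 (FForall 1 (FImp (incident 0 1) (FNot P))).

(** With h the monotone CNF whose clauses are the rows, h holds at the chosen set
    X if every row meets X, and fails if some row avoids X. The formula says
    that h takes the same value at X and at the complement of X. *)
Definition balanced : formula full_sig :=
  FOr (FAnd (every_row_meets (chosen 1)) (every_row_meets (FNot (chosen 1))))
      (FAnd (some_row_avoids (chosen 1)) (some_row_avoids (FNot (chosen 1)))).

Definition superset_clause : formula full_sig :=
  @extension_clause structure_sig guess_sig true tt erefl [tuple 0].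

Definition balanced_sentence : eso structure_sig :=
  @Eso structure_sig guess_sig (FAnd superset_clause balanced) erefl.

Lemma balanced_sentence_extensional : extensional balanced_sentence.
Proof.
exists (fun=> true); split=> [[] []|[]] //; split=> //.
exists erefl, [tuple 0]; split=> //.
by right; left; left.
Qed.

Definition covers (D : finType) (E : rel D) (X : pred D) : bool :=
  [forall c, exists i, E c i && X i].

Definition balanced_at (D : finType) (E : rel D) (X : pred D) : bool :=
  covers E X == covers E (predC X).

Section Semantics.

Variables (D : finType) (A : interpretation structure_sig D).

Definition forced : pred D := fun i => [tuple i] \in A true.

Definition edge : rel D := fun c i => [tuple c; i] \in A false.

Lemma holds_incident (B : interpretation guess_sig D) v c i :
  holds (expand A B) v (incident c i) = edge (v c) (v i).
Proof.
have e : @map_tuple 2 _ _ v [tuple c; i] = [tuple v c; v i] by exact: val_inj.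
by rewrite /edge -e.
Qed.

Lemma holds_chosen (B : interpretation guess_sig D) v i :
  holds (expand A B) v (chosen i) = ([tuple v i] \in B tt).
Proof.
have e : @map_tuple 1 _ _ v [tuple i] = [tuple v i] by exact: val_inj.
by rewrite -e.
Qed.

Lemma holds_superset (B : interpretation guess_sig D) v :
  holds (expand A B) v superset_clause =
  [forall i, forced i ==> ([tuple i] \in B tt)].
Proof.
apply: eq_forallb => i.
have e : @map_tuple 1 _ _ (update v 0 i) [tuple 0] = [tuple i] by exact: val_inj.
by rewrite /forced -e.
Qed.

(** The two disjuncts of the matrix are the cases where h is true at both X and
    its complement and where it is false at both. *)
Lemma eso_holdsP : D ->
  eso_holds A balanced_sentence <->
  exists X : pred D, (forall i, forced i -> X i) /\ balanced_at edge X.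
Proof.
move=> d0; have holdsE (B : interpretation guess_sig D) (v : nat -> D) :
    holds (expand A B) v (eso_matrix balanced_sentence) =
    [forall i, forced i ==> ([tuple i] \in B tt)] &&
    balanced_at edge (fun i => [tuple i] \in B tt).
  rewrite -[LHS]/(holds (expand A B) v superset_clause && holds (expand A B) v balanced).
  rewrite holds_superset; congr (_ && _).
  have meets P (Q : pred D) : (forall w, holds (expand A B) w P = Q (w 1)) ->
      holds (expand A B) v (every_row_meets P) = covers edge Q.
    move=> PQ; apply: eq_forallb => c; apply: eq_existsb => i.
    by rewrite -[LHS]/(holds _ _ (incident 0 1) && holds _ _ P) holds_incident PQ.
  have avoids P (Q : pred D) : (forall w, holds (expand A B) w P = Q (w 1)) ->
      holds (expand A B) v (some_row_avoids P) = ~~ covers edge Q.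
    move=> PQ; rewrite negb_forall; apply: eq_existsb => c.
    rewrite negb_exists; apply: eq_forallb => i.
    rewrite -[LHS]/(holds _ _ (incident 0 1) ==> ~~ holds _ _ P) holds_incident PQ.
    by rewrite implybE -negb_and.
  pose Q : pred D := fun i => [tuple i] \in B tt.
  have holds1 w : holds (expand A B) w (chosen 1) = Q (w 1) := holds_chosen B w 1.
  have holdsN1 w : holds (expand A B) w (FNot (chosen 1)) = predC Q (w 1).
    by rewrite /= -holds1.
  transitivity (covers edge Q && covers edge (predC Q) ||
                ~~ covers edge Q && ~~ covers edge (predC Q)).
    by rewrite -(avoids _ Q holds1) -(avoids _ (predC Q) holdsN1)
               -(meets _ Q holds1) -(meets _ (predC Q) holdsN1).
  by rewrite /balanced_at -/Q; do 2 case: (covers _ _).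
split=> [[B hB]|[X [forcedX balX]]].
  have := hB (fun=> d0); rewrite holdsE => /andP[/forallP sub bal].
  exists (fun i => [tuple i] \in B tt); split=> // i; exact/implyP.
pose B : interpretation guess_sig D := fun=> [set t : 1.-tuple D | X (thead t)].
exists B => v; rewrite holdsE.
have BE i : ([tuple i] \in B tt) = X i by rewrite inE.
apply/andP; split.
  by apply/forallP => i; rewrite BE; apply/implyP/forcedX.
move: balX; congr is_true; congr (_ == _); apply: eq_forallb => c;
  by apply: eq_existsb => i; rewrite /= BE.
Qed.

End Semantics.

(** * Correctness of the reduction from structures *)

Definition flip n (x : {ffun 'I_n -> bool}) : {ffun 'I_n -> bool} :=
  [ffun i => ~~ x i].

Lemma not_dualP (I : cnf_pair) :
  ~ @yes monotone_dual I <->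
  exists x, cnf_function (cnf_g I) x = cnf_function (cnf_f I) (flip x).
Proof.
split=> [not_dual|[x gx] /(_ x)]; last first.
  by rewrite gx /dual -/(flip x); case: (cnf_function _ _).
case: (boolP [exists x, cnf_function (cnf_g I) x == cnf_function (cnf_f I) (flip x)]).
  by case/existsP=> x /eqP; exists x.
rewrite negb_exists => /forallP gx; case: not_dual => x.
by move: (gx x); rewrite /dual -/(flip x); do 2 case: (cnf_function _ _).
Qed.

(** Duality of two CNFs can be tested on the finitely many assignments, so a
    reduction whose target is the complement of Monotone Dual also reduces the
    complement of its source to Monotone Dual itself. *)
Lemma dual_stable (I : cnf_pair) :
  ~ ~ @yes monotone_dual I -> @yes monotone_dual I.
Proof.
move=> nn_dual x; apply/eqP; apply: contraT => /eqP ne; case: nn_dual => dual_I.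
by case: ne; apply: dual_I.
Qed.

Lemma encode_structureE (A : fin_structure structure_sig) :
  encode_structure A = encode_nat (last_element A).+1 ++
    [seq forced (relation A) i | i <- enum 'I_(last_element A).+1] ++
    flatten [seq [seq edge (relation A) c i | i <- enum 'I_(last_element A).+1]
            | c <- enum 'I_(last_element A).+1].
Proof.
rewrite /encode_structure; congr (_ ++ _).
have -> : enum (symbol structure_sig) = [:: true; false] by rewrite enumT unlock.
rewrite /= cats0; set s := enum _.
have tuples1 : tuples_over s 1 = [seq [tuple i] | i <- s].
  rewrite /=; elim: (s) => //= i s' ->; congr (_ :: _); exact: val_inj.
congr (_ ++ _).
  rewrite -[flatten _]/(tuples_over s 1) tuples1 -map_comp; exact: eq_map.
have tuples2 : tuples_over s 2 = flatten [seq [seq [tuple c; i] | i <- s] | c <- s].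
  rewrite -[LHS]/(flatten [seq [seq cons_tuple c t | t <- tuples_over s 1] | c <- s]).
  rewrite tuples1; congr flatten; apply: eq_map => c; rewrite -map_comp.
  apply: eq_map => i; exact: val_inj.
rewrite -[X in map _ X]/(tuples_over s 2) tuples2 map_flatten -map_comp.
by congr flatten; apply: eq_map => c /=; rewrite -map_comp.
Qed.

Section StructureToCnf.

Variable A : fin_structure structure_sig.

Let N := (last_element A).+1.

Definition cnf_of_structure : cnf_pair :=
  @CnfPair N
    [seq [seq i <- enum 'I_N | edge (relation A) c i || forced (relation A) i]
    | c <- enum 'I_N]
    ([seq [seq i <- enum 'I_N | edge (relation A) c i] | c <- enum 'I_N] ++
     [seq [:: i] | i <- enum 'I_N & forced (relation A) i]).

(** Let g be the CNF of the rows with the unit clauses of the forced elements, and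
    f that of the rows enlarged by the forced elements. If X misses a forced
    element then g is false at X, and f is true at the complement of X because
    all its clauses contain that element. Hence f and g can only violate duality
    at an X containing the forced elements, and for such X the enlargement does
    not matter and the unit clauses hold. *)
Lemma cnf_of_structure_correct :
  eso_holds (relation A) balanced_sentence <-> ~ @yes monotone_dual cnf_of_structure.
Proof.
rewrite eso_holdsP; last exact: ord0.
rewrite not_dualP /=; set E := edge _; set Y := forced _.
have fE x : cnf_function (cnf_f cnf_of_structure) (flip x) =
    [forall c, exists i, (E c i || Y i) && ~~ x i].
  apply/allP/forallP => [all_f c|all_f _ /mapP[c _ ->]].
    have /hasP[i] := all_f _ (map_f _ (mem_enum _ c)).
    by rewrite mem_filter ffunE => /andP[h _] xi; apply/existsP; exists i; rewrite h.
  have /existsP[i /andP[h xi]] := all_f c.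
  by apply/hasP; exists i; [rewrite mem_filter h mem_enum | rewrite ffunE].
have gE x : cnf_function (cnf_g cnf_of_structure) x =
    covers E x && [forall i, Y i ==> x i].
  rewrite /cnf_function all_cat; congr (_ && _).
    apply/allP/forallP => [all_g c|all_g _ /mapP[c _ ->]].
      have /hasP[i] := all_g _ (map_f _ (mem_enum _ c)).
      by rewrite mem_filter => /andP[h _] xi; apply/existsP; exists i; apply/andP.
    have /existsP[i /andP[h xi]] := all_g c.
    by apply/hasP; exists i; first by rewrite mem_filter mem_enum andbT.
  apply/allP/forallP => [all_g i|all_g _ /mapP[i i_in ->]].
    apply/implyP => Yi; have := all_g [:: i]; rewrite /= orbF; apply.
    by apply: map_f; rewrite mem_filter mem_enum andbT.
  move: i_in; rewrite mem_filter /= orbF => /andP[Yi _].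
  exact: implyP (all_g i) Yi.
split=> [[X [YX bal]]|[x]].
  exists [ffun i => X i]; rewrite fE gE.
  have -> : [forall i, Y i ==> [ffun i => X i] i].
    by apply/forallP=> i; rewrite ffunE; apply/implyP/YX.
  rewrite andbT; have := bal; rewrite /balanced_at.
  have -> : covers E [ffun i => X i] = covers E X.
    by apply: eq_forallb => c; apply: eq_existsb => i; rewrite ffunE.
  move/eqP->; apply: eq_forallb => c; apply: eq_existsb => i; rewrite ffunE /=.
  by case: (E c i); case: (Y i) (YX i); case: (X i) => //= /(_ isT).
rewrite fE gE; case: forallP => [Yx|]; last first.
  rewrite andbF => not_Yx all_f; exfalso; apply: not_Yx => i; apply/implyP => Yi.
  case xi: (x i) => //; rewrite all_f.
  by apply/forallP=> c; apply/existsP; exists i; rewrite Yi orbT xi.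
rewrite andbT => gx; exists x; split=> [i|]; first exact/implyP.
rewrite /balanced_at gx; apply/eqP; apply: eq_forallb => c; apply: eq_existsb => i /=.
by have := Yx i; case: (E c i); case: (Y i); case: (x i).
Qed.

Lemma encode_cnf_of_structure :
  let x := [seq forced (relation A) i | i <- enum 'I_N] in
  let rs := [seq [seq edge (relation A) c i | i <- enum 'I_N] | c <- enum 'I_N] in
  encode_cnf_pair cnf_of_structure =
  encode_nat N ++ rcons (rows_listing true rs x) false ++
  rcons (rows_listing false rs x ++ unit_listing 0 x) false.
Proof.
move=> x rs.
have listingE k (s : seq 'I_N) (p : pred 'I_N) : map val s = iota k (size s) ->
    listing k (map p s) = flatten [seq true :: encode_nat (val i) | i <- s & p i].
  elim: s k => //= i s IH k [<- /IH ->]; by case: ifP.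
have unit_listingE k (s : seq 'I_N) (p : pred 'I_N) : map val s = iota k (size s) ->
    unit_listing k (map p s) =
    flatten [seq true :: encode_seq (fun i : 'I_N => encode_nat i) [:: i] | i <- s & p i].
  elim: s k => //= i s IH k [<- /IH ->]; by case: ifP.
have enum_iota : map val (enum 'I_N) = iota 0 (size (enum 'I_N)).
  by rewrite val_enum_ord size_enum_ord.
rewrite /encode_cnf_pair; congr (_ ++ (_ ++ _)).
  rewrite /encode_cnf /encode_seq /rows_listing -!map_comp; congr (rcons (flatten _) _).
  apply: eq_map => c /=; congr (_ :: rcons _ _).
  rewrite -(listingE 0) //; congr listing.
  by rewrite /combine /x; elim: (enum _) => //= i s ->.
rewrite /encode_cnf /encode_seq map_cat flatten_cat; congr (rcons (_ ++ _) _).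
  rewrite /rows_listing -!map_comp; congr flatten.
  apply: eq_map => c /=; congr (_ :: rcons _ _).
  rewrite -(listingE 0) //; congr listing.
  by rewrite /combine /x; elim: (enum _) => //= i s IH; rewrite orbF; congr (_ :: _).
by rewrite /x unit_listingE // -map_comp.
Qed.

End StructureToCnf.

Lemma cnf_of_structure_polytime :
  @polytime (eso_problem balanced_sentence) monotone_dual cnf_of_structure.
Proof.
apply: (@polytime_of_runs (eso_problem balanced_sentence) monotone_dual
  structure_to_cnf 1000 3) => A.
rewrite -[encode A]/(encode_structure A) -[encode (_ A)]/(encode_cnf_pair _).
rewrite encode_cnf_of_structure encode_structureE.
apply: runs_structure_to_cnf => //; try by rewrite size_map size_enum_ord.
by apply/allP=> _ /mapP[c _ ->]; rewrite size_map size_enum_ord.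
Qed.

(** * Correctness of the reduction from CNF pairs *)

Definition cnf_row_list (N : nat) (m : bool) (phi : nat_cnf) : seq (seq bool) :=
  rcons (flatten
    [seq rcons (nseq (size (members c)).+1 (pad_row N)) (clause_row N m c) | c <- phi])
  (pad_row N).

Lemma flatten_cnf_row_list N m phi : flatten (cnf_row_list N m phi) = cnf_rows N m phi.
Proof.
rewrite /cnf_row_list /cnf_rows flatten_rcons; congr (_ ++ _).
elim: phi => [//|c phi IH].
apply: etrans (flatten_cat _ _) _; rewrite IH.
by congr (_ ++ _); apply: flatten_rcons.
Qed.

Lemma size_cnf_row_rows N m phi r : r \in cnf_row_list N m phi -> size r = N.
Proof.
rewrite mem_rcons inE => /orP[/eqP ->|/flattenP[_ /mapP[c _ ->]]].
  by rewrite size_mkseq.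
rewrite mem_rcons inE => /orP[/eqP ->|/nseqP[-> _]]; by rewrite size_mkseq.
Qed.

(** One row for each bit of the code. *)
Lemma size_cnf_row_list N m phi :
  size (cnf_row_list N m phi) = size (encode_seq (encode_seq encode_nat) phi).
Proof.
rewrite !size_rcons; congr _.+1.
rewrite -/(clauses_code phi); elim: phi => [//|c phi IH].
rewrite clauses_codeS -cat_cons size_cat -[size (false :: _)]/(size _).+1 -IH addnS.
apply: etrans (size_cat _ _) _; by rewrite size_rcons size_nseq.
Qed.

Section Hits.

Variables (M : nat) (X : pred 'I_M.+1).

Let hit (r : seq bool) : bool := [exists i : 'I_M.+1, nth false r i && X i].

Lemma hit_bits p : hit (bits M.+1 p) = [exists i : 'I_M.+1, p i && X i].
Proof. by apply: eq_existsb => i; rewrite nth_mkseq. Qed.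

Hypothesis M_gt0 : 0 < M.

Lemma hit_pad : hit (pad_row M.+1) = X (inord 0) || X (inord 1).
Proof.
rewrite hit_bits; apply/existsP/orP => [[[[|[|k]] lt_k] //= Xk]|[X0|X1]].
- by left; congr X: Xk; apply: val_inj; rewrite /= inordK.
- by right; congr X: Xk; apply: val_inj; rewrite /= inordK.
- by exists (inord 0); rewrite inordK.
- by exists (inord 1); rewrite inordK.
Qed.

Lemma hit_clause_row m c : small M.+1 c ->
  hit (clause_row M.+1 m c) = X (inord m) || has (fun j => X (inord (j + 2))) c.
Proof.
move=> small_c; rewrite hit_bits; apply/existsP/orP => [[k]|].
  case: ltnP => lt_k /andP[].
    by move/eqP=> <- Xk; left; rewrite inord_val.
  by move=> kc Xk; right; apply/hasP; exists (k - 2) => //; rewrite subnK // inord_val.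
case=> [Xm|/hasP[j jc Xj]].
  exists (inord m); rewrite Xm andbT inordK; last by case: (m); lia.
  by rewrite eqxx; case: (m).
exists (inord (j + 2)); rewrite Xj andbT inordK; last exact: (allP small_c).
by rewrite addnK jc; case: ltnP => //; lia.
Qed.

Lemma all_hit_cnf m phi : all (small M.+1) phi ->
  all hit (cnf_row_list M.+1 m phi) =
  (X (inord 0) || X (inord 1)) &&
  (X (inord m) || all (has (fun j => X (inord (j + 2)))) phi).
Proof.
rewrite all_rcons hit_pad; case: (_ || _) (hit_pad) => //= pad_hit.
elim: phi => [|c phi IH] /=; first by rewrite orbT.
case/andP=> small_c small_phi.
rewrite all_cat all_rcons /= all_nseq /= pad_hit orbT andbT /= hit_clause_row // IH //.
by rewrite -orb_andr.
Qed.

End Hits.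

Section CnfToStructureProblem.

Variable I : cnf_pair.

Let n := nvars I.
Let N := size (encode_cnf_pair I).
Let M := N.-1.

Definition nats (phi : monotone_cnf n) : nat_cnf := [seq map val c | c <- phi].

Lemma encode_nats phi : encode_cnf phi = encode_seq (encode_seq encode_nat) (nats phi).
Proof.
rewrite /encode_cnf /encode_seq /nats -map_comp; congr (rcons (flatten _) _).
by apply: eq_map => c /=; rewrite -map_comp.
Qed.

Definition row_list : seq (seq bool) :=
  nseq n.+1 (pad_row N) ++ cnf_row_list N false (nats (cnf_f I)) ++
  cnf_row_list N true (nats (cnf_g I)).

Lemma size_row_list : size row_list = N.
Proof.
rewrite !size_cat size_nseq !size_cnf_row_list -!encode_nats.
by rewrite /N /encode_cnf_pair !size_cat size_encode_nat.
Qed.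

Lemma N_gt_n : n.+3 <= N.
Proof.
rewrite /N /encode_cnf_pair !size_cat size_encode_nat /encode_cnf /encode_seq !size_rcons.
by rewrite -/n; lia.
Qed.

Lemma M_succ : M.+1 = N.
Proof. by rewrite prednK //; have := N_gt_n; lia. Qed.

Lemma small_nats phi : all (small N) (nats phi).
Proof.
apply/allP=> _ /mapP[c _ ->]; apply/allP=> _ /mapP[i _ ->].
by have := ltn_ord i; have := N_gt_n; rewrite -/n /=; lia.
Qed.

Definition structure_of_cnf : fin_structure structure_sig :=
  @FinStructure structure_sig M (fun R : bool =>
    match R return {set (if R then 1 else 2).-tuple 'I_M.+1} with
    | true => set0
    | false => [set t : 2.-tuple 'I_M.+1 |
                 nth false (nth [::] row_list (tnth t ord0)) (tnth t ord_max)]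
    end).

Lemma edge_of_cnf c i :
  edge (relation structure_of_cnf) c i = nth false (nth [::] row_list c) i.
Proof. by rewrite /edge inE. Qed.

Lemma forced_of_cnf i : forced (relation structure_of_cnf) i = false.
Proof. by rewrite /forced in_set0. Qed.

(** The rows form the CNF (y or z) and (y or f) and (z or g), padding rows being
    copies of its first clause. *)
Lemma covers_of_cnf (X : pred 'I_M.+1) :
  covers (edge (relation structure_of_cnf)) X =
  [&& X (inord 0) || X (inord 1),
      X (inord 0) || all (has (fun j => X (inord (j + 2)))) (nats (cnf_f I)) &
      X (inord 1) || all (has (fun j => X (inord (j + 2)))) (nats (cnf_g I))].
Proof.
have M_gt0 : 0 < M by have := N_gt_n; rewrite -M_succ; lia.
transitivity (all (fun r => [exists i : 'I_M.+1, nth false r i && X i]) row_list).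
  apply/forallP/allP => [all_c r|all_r c].
    case/(nthP [::]) => k; rewrite size_row_list -M_succ => lt_k <-.
    have /existsP[i] := all_c (Ordinal lt_k); rewrite edge_of_cnf => h.
    by apply/existsP; exists i.
  have /existsP[i h] : [exists i : 'I_M.+1, nth false (nth [::] row_list c) i && X i].
    by apply: all_r; rewrite mem_nth // size_row_list -M_succ.
  by apply/existsP; exists i; rewrite edge_of_cnf.
rewrite /row_list !all_cat all_nseq /= -M_succ hit_pad // !all_hit_cnf //; last first.
- by rewrite M_succ small_nats.
- by rewrite M_succ small_nats.
by case: (X (inord 0)); case: (X (inord 1)); rewrite ?andbT.
Qed.

(** The CNF h = (y or z) and (y or f) and (z or g) takes opposite values at a set
    and its complement if y = z. If y = 1 and z = 0 its values are g(x) and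
    f(not x), and the case y = 0 and z = 1 is the same for the complement. So h
    agrees with itself at complementary points iff g(x) = f(not x) for some x. *)
Lemma structure_of_cnf_correct :
  ~ @yes monotone_dual I <-> eso_holds (relation structure_of_cnf) balanced_sentence.
Proof.
rewrite eso_holdsP; last exact: ord0.
rewrite not_dualP.
have cnfE (X : pred 'I_M.+1) phi :
    all (has (fun j => X (inord (j + 2)))) (nats phi) =
    cnf_function phi [ffun i : 'I_n => X (inord (i + 2))].
  rewrite all_map; apply: eq_all => c; rewrite /= has_map; apply: eq_has => i.
  by rewrite /= ffunE.
have flipE (X : pred 'I_M.+1) :
    [ffun i : 'I_n => predC X (inord (i + 2))] = flip [ffun i : 'I_n => X (inord (i + 2))].
  by apply/ffunP=> i; rewrite !ffunE.
split=> [[x gx]|[X [_]]]; last first.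
  rewrite /balanced_at !covers_of_cnf !cnfE !flipE /=.
  set x := [ffun i => _]; case: (X _); case: (X _) => //=; rewrite ?andbT ?orbT /=.
    by move/eqP=> gx; exists x.
  move/eqP=> fx; exists (flip x); rewrite -fx; congr cnf_function.
  by apply/ffunP=> i; rewrite !ffunE negbK.
(* X contains y, does not contain z, and is x on the shifted variables. *)
pose X : pred 'I_M.+1 := fun k => (val k == 0) || [exists i : 'I_n, (val k == i + 2) && x i].
have N_gtn := N_gt_n; rewrite -M_succ in N_gtn.
have xE : [ffun i : 'I_n => X (inord (i + 2))] = x.
  apply/ffunP=> i; rewrite ffunE /X /= inordK; last by have := ltn_ord i; lia.
  rewrite addn2 /=; apply/existsP/idP => [[j /andP[/eqP[]]]|xi].
    by rewrite addn2 => -[/val_inj ->].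
  by exists i; rewrite addn2 eqxx.
have X0 : X (inord 0) by rewrite /X /= inordK.
have X1 : X (inord 1) = false.
  rewrite /X /= inordK; last by lia.
  by apply/existsP=> -[j]; rewrite addn2.
exists X; split=> [i|]; first by rewrite forced_of_cnf.
by rewrite /balanced_at !covers_of_cnf !cnfE !flipE xE /= X0 X1 /= gx andbT.
Qed.

Lemma encode_structure_of_cnf :
  encode_structure structure_of_cnf =
  encode_nat N ++ bits N (fun=> false) ++
  pads N n.+1 ++ cnf_rows N false (nats (cnf_f I)) ++ cnf_rows N true (nats (cnf_g I)).
Proof.
have mkseqE (T : Type) (p : nat -> T) : [seq p (val i) | i <- enum 'I_M.+1] = mkseq p M.+1.
  by rewrite /mkseq -val_enum_ord -map_comp.
rewrite encode_structureE -[last_element _]/M.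
congr (_ ++ _); first by rewrite M_succ.
have -> : [seq forced (relation structure_of_cnf) i | i <- enum 'I_M.+1] = bits N (fun=> false).
  rewrite -M_succ /bits -mkseqE; apply: eq_map => i; exact: forced_of_cnf.
congr (_ ++ _).
rewrite -!flatten_cnf_row_list -!flatten_cat -/row_list; congr flatten.
transitivity (mkseq (nth [::] row_list) M.+1); last first.
  by rewrite M_succ -size_row_list mkseq_nth.
rewrite -mkseqE; apply: eq_map => c.
rewrite (eq_map (edge_of_cnf c)) (mkseqE _ (nth false (nth [::] row_list (val c)))).
have sz : size (nth [::] row_list c) = M.+1.
  apply: etrans (esym M_succ).
  have : nth [::] row_list c \in row_list by rewrite mem_nth // size_row_list -M_succ.
  rewrite mem_cat mem_cat => /or3P[/nseqP[-> _]|/size_cnf_row_rows|/size_cnf_row_rows] //.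
  by rewrite size_mkseq.
by move: (nth _ _ _) sz => r <-; apply: mkseq_nth.
Qed.

End CnfToStructureProblem.

Lemma structure_of_cnf_polytime :
  @polytime monotone_dual (eso_problem balanced_sentence) structure_of_cnf.
Proof.
apply: (@polytime_of_runs monotone_dual (eso_problem balanced_sentence)
  cnf_to_structure 500 2) => I.
rewrite -[encode I]/(encode_cnf_pair I) -[encode (_ I)]/(encode_structure (structure_of_cnf I)).
rewrite encode_structure_of_cnf {1}/encode_cnf_pair !encode_nats.
apply: runs_cnf_to_structure.
- by have := N_gt_n I; lia.
- by rewrite -!encode_nats.
- exact: small_nats.
- exact: small_nats.
Qed.

(** * Polynomial-time equivalence *)

Theorem mainTheorem11 :
  exists (tau : signature) (Gamma : eso tau),
    extensional Gamma /\
    polytime_equivalent (eso_problem Gamma) (complement monotone_dual) /\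
    polytime_equivalent (complement (eso_problem Gamma)) monotone_dual.
Proof.
have to_cnf := cnf_of_structure_correct.
have to_structure := structure_of_cnf_correct.
exists structure_sig, balanced_sentence.
split; first exact: balanced_sentence_extensional.
split; split.
- by exists cnf_of_structure; split=> [|A]; [exact: cnf_of_structure_polytime | exact: to_cnf].
- exists structure_of_cnf; split=> [|I]; first exact: structure_of_cnf_polytime.
  exact: to_structure.
- exists cnf_of_structure; split=> [|A]; first exact: cnf_of_structure_polytime.
  split=> [not_sat|dual_A sat]; last exact: (to_cnf A).1 sat dual_A.
  by apply: dual_stable => /(to_cnf A).2.
- exists structure_of_cnf; split=> [|I]; first exact: structure_of_cnf_polytime.
  split=> [dual_I sat|not_sat]; first exact: (to_structure I).2 sat dual_I.
  by apply: dual_stable => /(to_structure I).1.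
Qed.
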